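(* For all integers $m \ge 3$ and $n \ge m^2$, $\mathrm{sat}^*(n,mK_2) \le 3\binom{m}{2}$.
   Context: All graphs are finite and simple; $mK_2$ is the matching consisting of $m$ vertex-disjoint edges. An edge-colouring of a graph is proper if incident edges receive different colours, and a subgraph is rainbow if all of its edges receive pairwise distinct colours. A graph $G$ is properly rainbow $H$-saturated if (1) there is a proper edge-colouring of $G$ (with any set of colours) containing no rainbow copy of $H$, and (2) for every edge $e$ of the complement $\overline{G}$, every proper edge-colouring of $G+e$ contains a rainbow copy of $H$. The proper rainbow saturation number $\mathrm{sat}^*(n,H)$ is the minimum number of edges in an $n$-vertex properly rainbow $H$-saturated graph. *)

(* Defs.v *)
From mathcomp Require Import all_boot.

Set Implicit Arguments.
Unset Strict Implicit.
Unset Printing Implicit Defensive.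

Record sgraph (V : finType) := SGraph {
  edges : {set {set V}};
  edges_card2 : [forall e in edges, #|e| == 2]
}.

Lemma add_edge_card2 (V : finType) (G : sgraph V) (e : {set V}) :
  #|e| == 2 -> [forall x in e |: edges G, #|x| == 2].
Proof.
move=> e2; apply/forall_inP => x /setU1P[-> //|xG].
by move/forall_inP: (edges_card2 G); apply.
Qed.

Definition add_edge (V : finType) (G : sgraph V) (e : {set V})
    (e2 : #|e| == 2) : sgraph V :=
  SGraph (add_edge_card2 G e2).

(* An edge-colouring with colours in T is a function {set V} -> T of which
   only the values on the edges of G matter. *)
Definition proper_colouring (V : finType) (G : sgraph V) (T : Type)
    (c : {set V} -> T) : Prop :=
  forall e e', e \in edges G -> e' \in edges G ->
    e != e' -> e :&: e' != set0 -> c e <> c e'.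

(* Copies are subgraphs, not necessarily induced. *)
Definition is_copy (W V : finType) (H : sgraph W) (G : sgraph V)
    (f : W -> V) : Prop :=
  injective f /\ (forall e, e \in edges H -> f @: e \in edges G).

Definition rainbow_copy (W V : finType) (H : sgraph W) (G : sgraph V)
    (T : Type) (c : {set V} -> T) : Prop :=
  exists f : W -> V, is_copy H G f /\
    (forall e e', e \in edges H -> e' \in edges H ->
       e != e' -> c (f @: e) <> c (f @: e')).

Definition properly_rainbow_saturated (W V : finType) (H : sgraph W)
    (G : sgraph V) : Prop :=
  (exists (T : Type) (c : {set V} -> T),
     proper_colouring G c /\ ~ rainbow_copy H G c) /\
  (forall (e : {set V}) (e2 : #|e| == 2), e \notin edges G ->
     forall (T : Type) (c : {set V} -> T),
       proper_colouring (add_edge G e2) c ->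
       rainbow_copy H (add_edge G e2) c).

(* sat^*(n, H) = s.  Stated as a relation so that no junk value is needed
   when no n-vertex graph is properly rainbow H-saturated. *)
Definition is_sat_star (n : nat) (W : finType) (H : sgraph W) (s : nat)
    : Prop :=
  (exists G : sgraph 'I_n,
     properly_rainbow_saturated H G /\ #|edges G| = s) /\
  (forall G : sgraph 'I_n,
     properly_rainbow_saturated H G -> s <= #|edges G|).

Lemma matching_card2 (m : nat) :
  [forall e in [set [set (i, false); (i, true)] | i : 'I_m], #|e| == 2].
Proof.
by apply/forall_inP => e /imsetP[i _ ->]; rewrite cards2 xpair_eqE andbF.
Qed.

Definition matching (m : nat) : sgraph ('I_m * bool)%type :=
  SGraph (matching_card2 m).

(* Main.v *)
Require Import Defs.
From mathcomp Require Import all_boot.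
From Stdlib Require Import ClassicalEpsilon.

(* The graph is K_m with m - 1 pendant edges ("spokes") at each of its vertices,
   together with isolated vertices.  The vertices of K_m cover all edges, so an
   m-matching consists of one spoke at each of them; giving the spokes at every
   vertex the same m - 1 colours leaves no rainbow one.

   Let e = xy be a new edge and consider a proper colouring.  If the sets of
   spoke colours at the m vertices are not all equal, they have a transversal,
   which is a rainbow m-matching of spokes.  Otherwise they are all equal to
   some P, and no edge of K_m has its colour in P.  Choose i <> j such that x, y
   lie on no spoke at another vertex of K_m, with y outside K_m.
   - If c(e) is not in P, take e and spokes at all vertices but i, choosing
     first the one at j, which must avoid y.
   - If c(e) is in P, then e avoids K_m; take e, the edge ij, and spokes at the
     other m - 2 vertices with colours in P \ {c(e)}. *)

Set Implicit Arguments.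
Unset Strict Implicit.
Unset Printing Implicit Defensive.

(** * Classical reductions *)

(** Being saturated quantifies over all colour types and has no evident decision procedure, so
    excluded middle turns [P] into a boolean predicate before minimising. *)
Lemma least_of_ex (P : nat -> Prop) n :
  P n -> exists s, [/\ P s, s <= n & forall k, P k -> s <= k].
Proof.
move=> Pn; pose b k := if excluded_middle_informative (P k) then true else false.
have bP k : b k <-> P k by rewrite /b; case: excluded_middle_informative.
have exb : exists k, b k by exists n; apply/bP.
case: (ex_minnP exb) => s /bP Ps smin; exists s; split=> //.
  by apply: smin; apply/bP.
by move=> k /bP; apply: smin.
Qed.

(** Each colour is replaced by its colour class. In a finite colour type, sets of colours can be
    counted. *)
Lemma finite_colours (A : finType) (T : Type) (c : A -> T) :
  exists (C : finType) (d : A -> C), forall x y, d x = d y <-> c x = c y.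
Proof.
exists {set A}, (fun x =>
  [set y | if excluded_middle_informative (c x = c y) then true else false]).
move=> x y; split=> [/setP/(_ y)|->//].
by rewrite !inE; do 2!case: excluded_middle_informative.
Qed.

(** * Distinct representatives *)

(** Choose in the order of [s]: when [k] is reached, only [index k s] colours are taken. The colour
    [x0] fills the values outside [s]. *)
Lemma greedy_transversal (I C : finType) (x0 : C) (A : I -> {set C}) s :
  uniq s -> {in s, forall k, index k s < #|A k|} ->
  exists g : I -> C, {in s, forall k, g k \in A k} /\ {in s &, injective g}.
Proof.
elim/last_ind: s => [|s x IH]; first by exists (fun=> x0).
rewrite rcons_uniq => /andP[xs us] sA.
have [k ks|g [gA gI]] := IH us.
  have := sA k; rewrite mem_rcons inE ks orbT -cats1 index_cat ks; exact.
have [z zA zg] : exists2 z, z \in A x & z \notin [seq g k | k <- s].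
  apply/exists_inP; rewrite -[X in is_true X]negbK negb_exists_in.
  apply/negP=> /forall_inP sub.
  have := sA x; rewrite mem_rcons inE eqxx -cats1 index_cat (negPf xs) /= eqxx.
  rewrite addn0 => /(_ isT); rewrite ltnNge -(size_map g) => /negP; apply.
  apply: leq_trans (card_size _); apply/subset_leq_card/subsetP=> z /sub.
  by rewrite negbK.
have zgk k : k \in s -> z <> g k.
  by move=> ks zE; move: zg; rewrite zE map_f.
exists (fun k => if k == x then z else g k); split=> [k|k l];
  rewrite !mem_rcons !inE.
  by case: eqP => [->|_ /= /gA].
case: (eqVneq k x) => [->|_] /=; case: (eqVneq l x) => [->|_] //=.
- by move=> _ ls /(zgk _ ls).
- by move=> ks _ /esym/(zgk _ ks).
exact: gI.
Qed.

(** A list rather than a set, since its order is the greedy order: an index with few choices is put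
    in front, one with a spare choice at the end. *)
Definition others n (i j : 'I_n) := rem j (rem i (enum 'I_n)).

Lemma others_uniq n (i j : 'I_n) : uniq (others i j).
Proof. by rewrite !rem_uniq ?enum_uniq. Qed.

Lemma mem_others n (i j k : 'I_n) :
  (k \in others i j) = (k != j) && (k != i).
Proof.
by rewrite mem_rem_uniq ?rem_uniq ?enum_uniq// inE mem_rem_uniq ?enum_uniq//
  !inE mem_enum andbT.
Qed.

Lemma size_others n (i j : 'I_n) : i != j -> size (others i j) = n.-2.
Proof.
move=> ij; rewrite !size_rem ?size_enum_ord ?mem_enum//.
by rewrite mem_rem_uniq ?enum_uniq// !inE mem_enum andbT eq_sym.
Qed.

Lemma index_others n (i j k : 'I_n) :
  i != j -> k != i -> k != j -> index k (others i j) < n.-2.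
Proof.
by move=> ij ki kj; rewrite -(size_others ij) index_mem mem_others ki kj.
Qed.

(** Let [z] lie in [S i] but not in [S j]. Serve [i] first, with [z], and [j] last. Indices in
    between have at most [p - 1] predecessors; [j] has [p], but one of them took [z], which costs
    [S j] nothing. *)
Lemma transversal_or_constant p (C : finType) (S : 'I_p.+1 -> {set C}) :
  (forall k, #|S k| = p) ->
  (exists g : 'I_p.+1 -> C, injective g /\ forall k, g k \in S k) \/
  (forall k l, S k = S l).
Proof.
move=> cS; have [/forallP eqS|] := boolP [forall k, [forall l, S k == S l]].
  by right=> k l; move/forallP: (eqS k) => /(_ l)/eqP.
rewrite negb_forall => /existsP[i]; rewrite negb_forall => /existsP[j neS].
left; have [z zi zj] : exists2 z, z \in S i & z \notin S j.
  by apply/subsetPn; apply: contra neS => sub; rewrite eqEcard sub !cS /=.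
have ij : i != j by apply: contraNneq neS => ->.
(* Adding [z] to [S j] is harmless, as [i] has taken the colour [z]. *)
pose A k := if k == i then [set z] else if k == j then z |: S j else S k.
have memE k : k \in i :: rcons (others i j) j.
  by rewrite inE mem_rcons inE mem_others; case: (k == i); case: (k == j).
have p_gt0 : 0 < p by rewrite -(cS i); apply/card_gt0P; exists z.
have [||g [gA gI]] := @greedy_transversal _ _ z A (i :: rcons (others i j) j).
- by rewrite /= mem_rcons inE mem_others rcons_uniq mem_others !eqxx others_uniq
    (negPf ij).
- move=> k _; rewrite /= /A eq_sym; case: eqVneq => [|ki]; first by rewrite cards1.
  rewrite -cats1 index_cat mem_others ki andbT; case: eqVneq => [->|kj] /=.
    by rewrite eqxx addn0 size_others// cardsU1 zj cS /= prednK.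
  by rewrite cS -[X in _ < X]prednK// ltnS index_others.
have gi : g i = z by have := gA i (memE i); rewrite /A eqxx => /set1P.
exists g; split=> [k l|k]; first exact: gI.
have := gA k (memE k); rewrite /A; case: eqP => [->|/eqP ki]; first by move=> /set1P->.
case: eqP => [->|//] /setU1P[gj|//].
by move: ij; rewrite (gI i j) ?eqxx// gi.
Qed.

(** * From disjoint edges to rainbow copies *)

Lemma disjoint_pairs (V : finType) (a b x y : V) :
  a != x -> a != y -> b != x -> b != y -> [disjoint [set a; b] & [set x; y]].
Proof.
move=> ax ay bx b_y; rewrite disjoint_subset; apply/subsetP => z.
by case/set2P=> ->; rewrite !inE negb_or ?ax ?ay ?bx ?b_y.
Qed.

(** A copy is a map on vertices, so the two ends of each [E k] have to be ordered first. *)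
Lemma rainbow_matching (V : finType) (G : sgraph V) (T : Type)
    (c : {set V} -> T) m (E : 'I_m -> {set V}) :
  (forall k, E k \in edges G) ->
  (forall k l, k != l -> [disjoint E k & E l] /\ c (E k) <> c (E l)) ->
  rainbow_copy (matching m) G c.
Proof.
move=> EG Edis.
have [ab abP] : exists ab : 'I_m -> V * V, forall k,
    (ab k).1 != (ab k).2 /\ E k = [set (ab k).1; (ab k).2].
  apply: (@fin_all_exists _ _ (fun k u => u.1 != u.2 /\ E k = [set u.1; u.2])).
  move=> k; have /cards2P[a [b [ne EE]]] := forall_inP (edges_card2 G) _ (EG k).
  by exists (a, b).
pose f (x : 'I_m * bool) := if x.2 then (ab x.1).2 else (ab x.1).1.
have fE i : f @: [set (i, false); (i, true)] = E i.
  by rewrite imsetU1 imset_set1 (abP i).2.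
have fin x : f x \in E x.1.
  by rewrite (abP x.1).2 /f !inE; case: x.2; rewrite eqxx ?orbT.
exists f; split; first split.
- move=> [k a] [l b] fkl; have [kl|kl] := eqVneq k l.
    subst l; congr (_, _); have := (abP k).1.
    by case: a b fkl => [] [] //; rewrite /f /= => ->; rewrite eqxx.
  have := disjointFr (Edis _ _ kl).1 (fin (k, a)).
  by rewrite fkl (fin (l, b)).
- by move=> e /imsetP[i _ ->]; rewrite fE.
move=> e e' /imsetP[i _ ->] /imsetP[j _ ->] ne; rewrite !fE.
by apply: (Edis _ _ _).2; apply: contraNneq ne => ->.
Qed.

(** * The graph and its number of edges *)

(* [h (k, None)] is the k-th vertex of the complete graph and [h (k, Some t)] its
   t-th leaf; here m = p.+1. *)
Definition spoke p (V : finType) (h : 'I_p.+1 * option 'I_p -> V) k t :=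
  [set h (k, None); h (k, Some t)].

Definition rim p (V : finType) (h : 'I_p.+1 * option 'I_p -> V) k l :=
  [set h (k, None); h (l, None)].

Definition corona_edges p (V : finType) (h : 'I_p.+1 * option 'I_p -> V) :=
  [set spoke h x.1 x.2 | x : 'I_p.+1 * 'I_p] :|:
  [set [set h (k, None) | k in A] |
     A : {set 'I_p.+1} in [set A : {set 'I_p.+1} | #|A| == 2]].

Lemma corona_edgeP p (V : finType) (h : 'I_p.+1 * option 'I_p -> V) e :
  reflect ((exists k t, e = spoke h k t) \/
           (exists k l, k != l /\ e = rim h k l))
          (e \in corona_edges h).
Proof.
apply: (iffP setUP) => [[/imsetP[[k t] _ ->]|/imsetP[A]]|].
- by left; exists k, t.
- rewrite inE => /cards2P[k [l [kl ->]]] ->; right; exists k, l.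
  by rewrite imsetU1 imset_set1.
case=> [[k [t ->]]|[k [l [kl ->]]]]; first by left; apply/imsetP; exists (k, t).
right; apply/imsetP; exists [set k; l]; first by rewrite inE cards2 kl.
by rewrite imsetU1 imset_set1.
Qed.

Lemma corona_card2 p (V : finType) (h : 'I_p.+1 * option 'I_p -> V) :
  injective h -> [forall e in corona_edges h, #|e| == 2].
Proof.
move=> hI; apply/forall_inP => e /corona_edgeP[[k [t ->]]|[k [l [kl ->]]]];
  by rewrite cards2 (inj_eq hI) xpair_eqE ?andbF// (negPf kl).
Qed.

(** The corona product of a complete graph on [p.+1] vertices, the hubs, with [p] isolated vertices.
    Vertices outside the image of [h] stay isolated. *)
Definition corona p (V : finType) (h : 'I_p.+1 * option 'I_p -> V)
  (hI : injective h) : sgraph V := SGraph (corona_card2 hI).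

(** The [p * p.+1] spokes account for twice the binomial coefficient, the edges between hubs for the
    third copy. *)
Lemma card_corona p (V : finType) (h : 'I_p.+1 * option 'I_p -> V)
    (hI : injective h) : #|edges (corona hI)| <= 3 * 'C(p.+1, 2).
Proof.
apply: leq_trans (leq_card_setU _ _) _; rewrite mulSn addnC leq_add//.
  by apply: leq_trans (leq_imset_card _ _) _; rewrite card_draws card_ord.
apply: leq_trans (leq_imset_card _ _) _.
by rewrite -mul_bin_diag bin1 card_prod !card_ord.
Qed.

Lemma spoke_inj p (V : finType) (h : 'I_p.+1 * option 'I_p -> V) k t l u :
  injective h -> spoke h k t = spoke h l u -> (k, t) = (l, u).
Proof.
move=> hI /setP/(_ (h (k, Some t))); rewrite !inE eqxx orbT !(inj_eq hI).
by rewrite !xpair_eqE andbF /= => /esym/andP[/eqP-> /eqP[->]].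
Qed.

Lemma spoke_neq_rim p (V : finType) (h : 'I_p.+1 * option 'I_p -> V) k t i j :
  injective h -> spoke h k t != rim h i j.
Proof.
move=> hI; apply/eqP => /setP/(_ (h (k, Some t))); rewrite !inE eqxx orbT.
by rewrite !(inj_eq hI) !xpair_eqE !andbF.
Qed.

(** * A colouring without a rainbow matching *)

Lemma corona_colouring p (V : finType) (h : 'I_p.+1 * option 'I_p -> V)
    (hI : injective h) :
  exists (T : Type) (c : {set V} -> T),
    proper_colouring (corona hI) c /\
    ~ rainbow_copy (matching p.+1) (corona hI) c.
Proof.
(* A spoke is coloured by the index of its leaf, any other edge by itself. *)
pose c (e : {set V}) : 'I_p + {set V} :=
  if [pick x : 'I_p.+1 * 'I_p | e == spoke h x.1 x.2] is Some x
  then inl x.2 else inr e.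
have cS k t : c (spoke h k t) = inl t.
  rewrite /c; case: pickP => [[l u] /= /eqP/(spoke_inj hI)[_ ->] //|].
  by move/(_ (k, t)); rewrite eqxx.
have cR k l : c (rim h k l) = inr (rim h k l).
  rewrite /c; case: pickP => [[i t]|//] /=.
  by rewrite eq_sym (negPf (spoke_neq_rim _ _ _ _ hI)).
exists _, c; split.
  move=> e e' /corona_edgeP[[k [t ->]]|[k [l [_ ->]]]];
    move=> /corona_edgeP[[i [u ->]]|[i [j [_ ->]]]]; rewrite ?cS ?cR //;
    last by move=> /eqP ne _ [/ne].
  move=> ne /set0Pn[z]; rewrite !inE => /andP[zk zi] [tu]; subst u.
  suff ki : k = i by rewrite ki eqxx in ne.
  by case/orP: zk zi => /eqP-> /orP[] /eqP/hI[].
move=> [f [[fI fE] fc]].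
pose M i : {set 'I_p.+1 * bool} := [set (i, false); (i, true)].
have ME i : M i \in edges (matching p.+1) by apply: imset_f.
have Mdis i j z : z \in f @: M i -> z \in f @: M j -> i = j.
  case/imsetP=> x xi -> /imsetP[y yj /fI xy]; subst y.
  by case/set2P: xi yj => -> /set2P[] [].
(* Each of the [p.+1] disjoint edges contains a hub, so [q] is a bijection onto the hubs. No edge
   can then contain two hubs, and all are spokes. *)
have hubE i : exists k, h (k, None) \in f @: M i.
  case/corona_edgeP: (fE _ (ME i)) => [[k [t ->]]|[k [l [_ ->]]]];
    by exists k; rewrite !inE eqxx.
have [q qP] := fin_all_exists hubE.
have qI : injective q.
  by move=> i j qij; apply: (Mdis i j (h (q i, None))); rewrite ?qP// qij qP.
have [r rK qK] := injF_bij qI.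
have tE i : exists t, c (f @: M i) = inl t.
  case/corona_edgeP: (fE _ (ME i)) => [[k [t ->]]|[k [l [kl Mkl]]]].
    by exists t; rewrite cS.
  have own z : h (z, None) \in f @: M i -> z = q i.
    by move=> zi; rewrite -(qK z); congr q; apply: Mdis zi; rewrite -{1}(qK z) qP.
  have kq : k = q i by apply: own; rewrite Mkl !inE eqxx.
  have lq : l = q i by apply: own; rewrite Mkl !inE eqxx orbT.
  by rewrite kq lq eqxx in kl.
have [t tP] := fin_all_exists tE.
(* Pigeonhole: a rainbow copy would inject [p.+1] edges into [p] spoke colours. *)
have tI : injective t.
  move=> i j tij; apply/eqP/negPn/negP => ij.
  apply: (fc _ _ (ME i) (ME j)); last by rewrite !tP tij.
  apply: contraNneq ij => /setP/(_ (i, true)).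
  by rewrite !inE eqxx orbT !xpair_eqE andbF andbT.
by have := leq_card _ tI; rewrite !card_ord ltnn.
Qed.

(** * Every added edge forces a rainbow matching *)

Lemma corona_add_edge p (V : finType) (h : 'I_p.+1 * option 'I_p -> V)
    (hI : injective h) (C : finType) (c : {set V} -> C) (e : {set V})
    (e2 : #|e| == 2) :
  1 < p -> e \notin edges (corona hI) ->
  proper_colouring (add_edge (corona hI) e2) c ->
  rainbow_copy (matching p.+1) (add_edge (corona hI) e2) c.
Proof.
move=> p_gt1 eG cP.
have eE : e \in edges (add_edge (corona hI) e2) by apply: setU11.
have spokeE k t : spoke h k t \in edges (add_edge (corona hI) e2).
  by apply/setU1r/corona_edgeP; left; exists k, t.
have rimE k l : k != l -> rim h k l \in edges (add_edge (corona hI) e2).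
  by move=> kl; apply/setU1r/corona_edgeP; right; exists k, l.
have spoke_neq_e k t : spoke h k t != e.
  by apply: contraNneq eG => <-; apply/corona_edgeP; left; exists k, t.
have cspoke k t e' : e' \in edges (add_edge (corona hI) e2) ->
    spoke h k t != e' -> h (k, None) \in e' -> c (spoke h k t) <> c e'.
  move=> e'E ne he'; apply: cP => //; apply/set0Pn.
  by exists (h (k, None)); rewrite !inE eqxx.
have cI k : injective (fun t => c (spoke h k t)).
  move=> t u /eqP ctu; apply/eqP/negPn/negP => tu; case/eqP: ctu.
  apply: cspoke => //; last by rewrite !inE eqxx.
  by apply: contraNneq tu => /(spoke_inj hI)[->].
have dspoke k l t u : k != l -> [disjoint spoke h k t & spoke h l u].
  by move=> kl; apply: disjoint_pairs; rewrite (inj_eq hI) xpair_eqE (negPf kl).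
pose S k := [set c (spoke h k t) | t : 'I_p].
have cS k : #|S k| = p by rewrite card_imset ?card_ord.
case: (transversal_or_constant cS) => [[g [gI gS]]|Sconst].
  have [t tP] : exists t, forall k, g k = c (spoke h k (t k)).
    apply: (@fin_all_exists _ _ (fun k t => g k = c (spoke h k t))) => k.
    by have /imsetP[t _ ->] := gS k; exists t.
  apply: (@rainbow_matching _ _ _ c _ (fun k => spoke h k (t k))) => //.
  move=> k l kl; split; first exact: dspoke.
  by rewrite -!tP => /gI; apply/eqP.
pose R (A B : {set V}) := [disjoint A & B] /\ c A <> c B.
(* [R] is what [rainbow_matching] asks of two distinct edges; its symmetry halves the case checks
   below. *)
have RC A B : R A B -> R B A.
  by case=> ? ?; split; rewrite 1?disjoint_sym// => /esym.
(* Two hubs are already adjacent, so some end of [e] is not a hub; call it [y]. *)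
have [x [y [xy eq_e yhub]]] : exists x y, [/\ x != y, e = [set x; y] &
    forall k, y != h (k, None)].
  have /cards2P[x [y [xy eq_e]]] := e2.
  have [/existsP[k /eqP yk]|] := boolP [exists k, y == h (k, None)]; last first.
    by rewrite negb_exists => /forallP yhub; exists x, y.
  exists y, x; split; rewrite 1?eq_sym 1?setUC// => l.
  apply: contraNneq eG => xl; apply/corona_edgeP; right; exists l, k.
  by rewrite eq_e xl yk; split=> //; apply: contraNneq xy => lk; rewrite xl yk lk.
(* The index of the star (a hub with its leaves) containing [z]. If [z] lies in no star, [ord0] is
   an arbitrary choice. *)
have owner z : exists i, forall k o, z = h (k, o) -> k = i.
  have [/existsP[[i o] /eqP zi]|] := boolP [exists a, z == h a].
    by exists i => k o'; rewrite zi => /hI[].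
  by rewrite negb_exists => /forallP zh; exists ord0 => k o zE;
    case/eqP: (zh (k, o)).
have [i xi] := owner x.
(* If [x] and [y] have the same owner [i], any other index serves as [j]. *)
have [j ij yj] : exists2 j, i != j & forall k o, y = h (k, o) -> k = i \/ k = j.
  have [j yj] := owner y; have [ij|ij] := eqVneq i j; last first.
    by exists j => // k o /yj; right.
  exists (lift i (Ordinal (ltnW p_gt1))); first exact: neq_lift.
  by move=> k o /yj ->; left.
have xk k o : k != i -> x != h (k, o).
  by apply: contraNneq => /xi->.
have dis_e k t : k != i -> y != h (k, Some t) -> [disjoint e & spoke h k t].
  by move=> ki yt; rewrite eq_e; apply: disjoint_pairs; rewrite ?xk.
have yk k o : k != i -> k != j -> y != h (k, o).
  by move=> /eqP ki /eqP kj; apply/eqP => /yj[].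
have Smem k l t : c (spoke h k t) \in S l by rewrite (Sconst l k) imset_f.
have [ceS|ceS] := boolP (c e \in S i); last first.
(* Since [1 < p], there are two leaves at [j], and [y] is at most one of them. *)
- have [t0 yt0] : exists t0, y != h (j, Some t0).
    have [yE|y0] := eqVneq y (h (j, Some (Ordinal (ltnW p_gt1)))); last first.
      by exists (Ordinal (ltnW p_gt1)).
    by exists (Ordinal p_gt1); rewrite yE (inj_eq hI) xpair_eqE eqxx.
  (* Serve [j] first, with the single colour of a spoke avoiding [y]. The other [p - 1] indices then
     have at most [p - 1] predecessors and [p] colours each. *)
  pose A k := if k == j then [set c (spoke h j t0)] else S k.
  have memE k : k != i -> k \in j :: others i j.
    by move=> ki; rewrite inE mem_others ki andbT; case: eqVneq.
  have [||g [gA gI]] := @greedy_transversal _ _ (c e) A (j :: others i j).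
  + by rewrite /= mem_others eqxx others_uniq.
  + move=> k; rewrite inE mem_others /A /= [j == k]eq_sym.
    case: eqVneq => [|kj] /= ki; first by rewrite cards1.
    by rewrite cS -[X in _ < X]prednK ?(ltnW p_gt1)// ltnS index_others.
  have [t tP] : exists t, forall k, k != i ->
      g k = c (spoke h k (t k)) /\ y != h (k, Some (t k)).
    apply: (@fin_all_exists _ _ (fun k t => k != i ->
      g k = c (spoke h k t) /\ y != h (k, Some t))) => k.
    have [->|ki] := eqVneq k i; first by exists t0.
    have := gA k (memE k ki); rewrite /A; case: eqVneq => [-> /set1P gj|kj].
      by exists t0.
    by case/imsetP=> t _ gk; exists t; rewrite yk.
  apply: (@rainbow_matching _ _ _ c _
    (fun k => if k == i then e else spoke h k (t k))).
  + by move=> k; case: eqP.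
  + have Re l : l != i -> R e (spoke h l (t l)).
      move=> li; have [_ yl] := tP l li; split; first exact: dis_e.
      by move=> ce; move: ceS; rewrite ce Smem.
    move=> k l; case: (eqVneq k i) => [->|ki]; case: (eqVneq l i) => [_|li] kl //.
    * exact: Re.
    * by apply: RC; apply: Re.
    * split; first exact: dspoke.
      rewrite -(tP k ki).1 -(tP l li).1 => /gI; rewrite !memE//.
      by move=> /(_ isT isT)/eqP; rewrite (negPf kl).
(* Every hub sees every colour of the common set on its spokes. By properness, no other edge at a
   hub has such a colour: this keeps [e] off the hubs and, in [crim], the colour of the edge [ij]
   out of the set. *)
have xhub k : x != h (k, None).
  apply/eqP => xE; move: ceS; rewrite (Sconst i k) => /imsetP[t _ /esym].
  by apply: cspoke => //; rewrite eq_e xE !inE eqxx.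
have crim k t : c (spoke h k t) <> c (rim h i j).
  move=> cE; have := Smem k i t; rewrite cE => /imsetP[u _ /esym].
  apply: cspoke; [exact: rimE|exact: spoke_neq_rim|by rewrite !inE eqxx].
have drim k t : k != i -> k != j -> [disjoint spoke h k t & rim h i j].
  by move=> ki kj; apply: disjoint_pairs;
    rewrite (inj_eq hI) xpair_eqE ?(negPf ki) ?(negPf kj).
have derim : [disjoint e & rim h i j].
  by rewrite eq_e; apply: disjoint_pairs.
(* Without [c e], the common set still has [p - 1] colours, enough for the [p - 1] remaining
   indices. *)
have [||g [gA gI]] :=
  @greedy_transversal _ _ (c e) (fun k => S k :\ c e) (others i j).
- exact: others_uniq.
- move=> k; rewrite mem_others => /andP[kj ki].
  have := cardsD1 (c e) (S k); rewrite cS (Sconst k i) ceS add1n => pE.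
  by apply: leq_trans (index_others ij ki kj) _; rewrite /= [X in X.-1]pE.
have [t tP] : exists t, forall k, k != i -> k != j ->
    g k = c (spoke h k (t k)) /\ g k <> c e.
  apply: (@fin_all_exists _ _ (fun k t => k != i -> k != j ->
    g k = c (spoke h k t) /\ g k <> c e)) => k.
  have [->|ki] := eqVneq k i; first by exists (Ordinal p_gt1).
  have [->|kj] := eqVneq k j; first by exists (Ordinal p_gt1).
  have := gA k; rewrite mem_others ki kj => /(_ isT).
  by case/setD1P=> /eqP gce /imsetP[t _ gk]; exists t.
have ce_rim : c e <> c (rim h i j).
  by case/imsetP: ceS => u _ ->; apply: crim.
apply: (@rainbow_matching _ _ _ c _ (fun k => if k == i then e else
  if k == j then rim h i j else spoke h k (t k))).
- by move=> k; do 2!case: eqP => // _; apply: rimE.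
have Re : R e (rim h i j) by [].
have Rs k : k != i -> k != j -> R e (spoke h k (t k)).
  move=> ki kj; have [gk gce] := tP k ki kj; split.
    by apply: dis_e; rewrite ?yk.
  by rewrite -gk => /esym.
have Rr k : k != i -> k != j -> R (rim h i j) (spoke h k (t k)).
  by move=> ki kj; apply: RC; split; [apply: drim|apply: crim].
move=> k l; rewrite -/(R _ _); case: (eqVneq k i) => [->|ki];
  case: (eqVneq l i) => [_|li] //.
- by case: (eqVneq l j) => [_|lj] _ //; apply: Rs.
- by case: (eqVneq k j) => [_|kj] _; apply: RC => //; apply: Rs.
case: (eqVneq k j) => [->|kj]; case: (eqVneq l j) => [_|lj] kl //.
- exact: Rr.
- by apply: RC; apply: Rr.
split; first exact: dspoke.
rewrite -(tP k ki kj).1 -(tP l li lj).1 => /gI; rewrite !mem_others ki kj li lj.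
by move=> /(_ isT isT)/eqP; rewrite (negPf kl).
Qed.

Theorem theorem4p9 (m n : nat) (hm : 3 <= m) (hn : m ^ 2 <= n) :
  exists s : nat, is_sat_star n (matching m) s /\ s <= 3 * 'C(m, 2).
Proof.
case: m hm hn => [//|p] hp hn.
(* With [m - 1] leaves at each of [m] hubs, the corona occupies [m ^ 2] vertices. *)
have le_n : #|{: 'I_p.+1 * option 'I_p}| <= n.
  by rewrite card_prod card_option !card_ord.
pose h x := widen_ord le_n (enum_rank x).
have hI : injective h by move=> x y [] /ord_inj/enum_rank_inj.
have sat : properly_rainbow_saturated (matching p.+1) (corona hI).
  split; first exact: corona_colouring.
  (* Properness and being rainbow depend only on which colours are equal, so [d] can stand in for
     [c]. *)
  move=> e e2 eG T c cP; have [C [d dP]] := finite_colours c.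
  have [||f [fG fd]] := @corona_add_edge _ _ _ hI C d e e2 _ eG; first by [].
    by move=> a b aG bG ab abI /dP; apply: cP.
  exists f; split=> // a b aM bM ab /dP; exact: fd.
have [s [[G [Gsat Gs]] s_le s_min]] := @least_of_ex (fun s => exists G : sgraph 'I_n,
  properly_rainbow_saturated (matching p.+1) G /\ #|edges G| = s) _
  (ex_intro _ _ (conj sat erefl)).
exists s; split; last exact: leq_trans s_le (card_corona hI).
by split=> [|H Hsat]; [exists G|apply: s_min; exists H].
Qed.
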